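(* Let $p$ be an odd prime and let $k$ be an integer with $1\leq k\leq p-1$. Then $$\sum_{i=1}^k\frac{1}{(k-i)!}\left(\sum_{m=1}^p\frac{(p-1)!}{(p-m)!\,(i+p)!}\left\{{i+p\atop m}\right\}_{\leq p-1}\right)-\frac{1}{(k-1)!}\equiv -\frac{1}{k!}H_k \pmod{p},$$ where $H_k=\sum_{j=1}^k\frac{1}{j}$ is the $k$-th harmonic number.
   Context: For integers $n\geq k\geq 0$ and $r\geq 1$, the $r$-restricted Stirling number of the second kind $\left\{{n\atop k}\right\}_{\leq r}$ is the number of partitions of an $n$-element set into $k$ nonempty blocks, each of size at most $r$; equivalently it is defined by the generating function $\frac{1}{k!}\left(\sum_{m=1}^r\frac{t^m}{m!}\right)^k=\sum_{n\geq k}\left\{{n\atop k}\right\}_{\leq r}\frac{t^n}{n!}$. The congruence is meant in the ring $\mathbb{Z}_{(p)}$ of rationals with denominator prime to $p$ (both sides lie in $\mathbb{Z}_{(p)}$), i.e. the difference of the two sides lies in $p\mathbb{Z}_{(p)}$. *)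

(* Defs.v *)
From mathcomp Require Import all_boot all_order all_algebra.

Set Implicit Arguments.
Unset Strict Implicit.
Unset Printing Implicit Defensive.

Import GRing.Theory.
Local Open Scope ring_scope.

(* [partition] already requires every block to be nonempty. *)
Definition restricted_stirling2 (r n k : nat) : nat :=
  #|[set P : {set {set 'I_n}} |
      [&& partition P [set: 'I_n], #|P| == k & [forall B in P, (#|B| <= r)%N]]]|.

Definition harmonic (k : nat) : rat := \sum_(1 <= j < k.+1) j%:R^-1.

(* The ring Z_(p), as a subset of the rationals; [denq x] is the positive
   denominator of x in lowest terms. *)
Definition Zloc (p : nat) : {pred rat} := [pred x : rat | coprimez (denq x) p%:Z].

(* x = y mod p in Z_(p): x, y are elements of Z_(p) and x - y is in p Z_(p). *)
Definition congr_Zloc (p : nat) (x y : rat) : Prop :=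
  [/\ x \in Zloc p, y \in Zloc p
    & exists2 z : rat, z \in Zloc p & x - y = p%:R * z].

(* Main.v *)
From HB Require Import structures.
Require Import Defs.
From mathcomp Require Import all_boot all_order all_algebra.
From mathcomp Require Import ring.

(** Let [F = \sum_(j < p) t^j / j!].  Since
    [(p-1)! / (p-m)! = 'C(p, m) m! / p] and [m! {n, m}_{<= p-1} / n!] is the
    coefficient of [t^n] in [(F - 1)^m], the inner sum is
    [b_(p+i) := [t^(p+i)] F^p / p] by the binomial theorem.  From
    [F' = F - t^(p-1) / (p-1)!] one gets
    [(p+i) b_(p+i) = p b_(p+i-1) - [t^i] F^(p-1) / (p-1)!], where
    [[t^i] F^(p-1) = (p-1)^i / i!] for [i < p].  With Wilson's theorem this gives
    [b_(p+i) = [i = 1] + (-1)^i / (i i!)] modulo [p], the exceptional term at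
    [i = 1] coming from [p b_p], a unit although [b_p] is not [p]-integral.
    The identity [\sum_i (-1)^i 'C(k, i) / i = - H_k] concludes. *)

Set Implicit Arguments.
Unset Strict Implicit.
Unset Printing Implicit Defensive.

Import GRing.Theory Num.Theory.
Local Open Scope ring_scope.

(** * The local ring [Zloc p] inside the rationals *)

Lemma Zloc_divq (p : nat) (n d : int) :
  coprimez d p%:Z -> n%:~R / d%:~R \in Zloc p.
Proof.
(* A zero denominator gives the quotient 0; otherwise [denq x] divides [d], hence inherits
   coprimality with [p]. *)
case: divqP => [_|k x k0]; first by rewrite inE /= /coprimez gcd1z.
by rewrite inE coprimezMl => /andP[].
Qed.

Lemma Zloc_subring_closed (p : nat) : subring_closed (Zloc p).
Proof.
have neq0 (x : rat) : (denq x)%:~R != 0 :> rat by rewrite intr_eq0 denq_eq0.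
split=> [|x y|x y]; first by rewrite inE /= /coprimez gcd1z.
  rewrite !inE => xp yp.
  have -> : x - y =
      (numq x * denq y - numq y * denq x)%:~R / (denq x * denq y)%:~R.
    rewrite -[x in LHS]divq_num_den -[y in LHS]divq_num_den rmorphB !rmorphM /=.
    by field; rewrite !neq0.
  by apply: Zloc_divq; rewrite coprimezMl xp.
rewrite !inE => xp yp.
have -> : x * y = (numq x * numq y)%:~R / (denq x * denq y)%:~R.
  rewrite -[x in LHS]divq_num_den -[y in LHS]divq_num_den !rmorphM /=.
  by field; rewrite !neq0.
by apply: Zloc_divq; rewrite coprimezMl xp.
Qed.

HB.instance Definition _ (p : nat) :=
  GRing.isSubringClosed.Build rat (Zloc p) (@Zloc_subring_closed p).

Lemma Zloc_invn (p n : nat) : coprime n p -> (n%:R)^-1 \in Zloc p.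
Proof. by move=> np; rewrite -[_^-1]mul1r; apply: (@Zloc_divq p 1 n). Qed.

Lemma Zloc_inv_fact (p n : nat) :
  prime p -> (n < p)%N -> (n`!%:R)^-1 \in Zloc p.
Proof.
move=> p_pr np; apply: Zloc_invn; elim: n np => [|n IHn] np.
  by rewrite coprime1n.
rewrite factS coprimeMl IHn 1?ltnW // andbT coprime_sym prime_coprime //.
by rewrite gtnNdvd.
Qed.

(** The truncated exponential; F is [expp q] with [p = q.+1]. The constant term 1 is kept so that
    the derivative differs from the polynomial by one monomial only. *)
Definition expp (r : nat) : {poly rat} := \poly_(j < r.+1) (j`!%:R)^-1.

Lemma coef_expp (r j : nat) :
  (expp r)`_j = if (j <= r)%N then (j`!%:R)^-1 else 0.
Proof. by rewrite coef_poly. Qed.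

Lemma coef_expp1 (r j : nat) :
  (expp r - 1)`_j = if (0 < j <= r)%N then (j`!%:R)^-1 else 0.
Proof.
rewrite coefB coef1 coef_expp.
by case: j => [|j] //=; rewrite ?subr0 // fact0 invr1 subrr.
Qed.

Lemma fact_neq0 (n : nat) : n`!%:R != 0 :> rat.
Proof. by rewrite pnatr_eq0 -lt0n fact_gt0. Qed.

(** * Generating function of partitions with bounded blocks *)

Section BoundedPartitions.

Variable T : finType.
Implicit Types (A B : {set T}) (r m : nat).

(** Stated for an arbitrary set [A], so that removing a block leaves an object of the same kind. *)
Definition bounded_partitions A r m :=
  [set P : {set {set T}} |
    [&& partition P A, #|P| == m & [forall B in P, (#|B| <= r)%N]]].

(** Inserting and deleting the block [B] are mutually inverse; [B], being nonempty, cannot already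
    be a block of a partition of [A :\: B]. *)
Lemma card_bounded_partitions_mem A r m B :
    B \subset A -> B != set0 -> (#|B| <= r)%N ->
  #|[set P in bounded_partitions A r m.+1 | B \in P]| =
  #|bounded_partitions (A :\: B) r m|.
Proof.
move=> sBA B0 Br.
have BnQ Q : partition Q (A :\: B) -> B \notin Q.
  move=> partQ; apply: contra B0 => /(partitionS partQ).
  by rewrite subsetD -setI_eq0 setIid => /andP[].
rewrite -(card_in_imset (f := fun Q => B |: Q)
  (D := mem (bounded_partitions (A :\: B) r m))).
  apply: eq_card => P; rewrite !inE; apply/andP/imsetP.
    case=> /and3P[partP /eqP cardP /forall_inP leP] BP.
    exists (P :\ B); last by rewrite setD1K.
    rewrite inE partitionD1 //=; apply/andP; split.
      by move: cardP; rewrite (cardsD1 B) BP add1n => -[->].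
    by apply/forall_inP=> C /setD1P[_ /leP].
  case=> Q; rewrite inE => /and3P[partQ /eqP cardQ /forall_inP leQ] ->.
  rewrite setU11 cardsU1 BnQ // cardQ; split=> //; apply/and3P; split=> //.
    have := partitionU1 partQ B0.
    rewrite [in X in _ -> X](_ : A = B :|: (A :\: B)).
      by apply; rewrite disjoint_sym -setI_eq0 setIDAC setDIl setDv setI0.
    by rewrite setDE setUIr setUCr setIT; apply/esym/setUidPr.
  by apply/forall_inP=> C /setU1P[-> //|/leQ].
move=> Q1 Q2; rewrite !inE => /and3P[/BnQ BQ1 _ _] /and3P[/BnQ BQ2 _ _] eqQ.
by rewrite -(setU1K BQ1) eqQ setU1K.
Qed.

(* Counts the pairs of a partition and one of its blocks in two ways. *)
Lemma card_bounded_partitionsS A r m :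
  (m.+1 * #|bounded_partitions A r m.+1| =
   \sum_(B : {set T} | [&& B \subset A, B != set0 & #|B| <= r])
      #|bounded_partitions (A :\: B) r m|)%N.
Proof.
transitivity (\sum_(P in bounded_partitions A r m.+1) \sum_(B in P) 1)%N.
  rewrite (eq_bigr (fun=> m.+1)); first by rewrite sum_nat_const mulnC.
  by move=> P; rewrite inE sum1_card => /and3P[_ /eqP].
rewrite (exchange_big_dep
  (fun B => [&& B \subset A, B != set0 & (#|B| <= r)%N])) /=; last first.
  move=> P B; rewrite inE => /and3P[partP _ /forall_inP leP] BP.
  by rewrite (partitionS partP BP) (partition_neq0 partP BP) leP.
apply: eq_bigr => B /and3P[sBA B0 Br].
rewrite -(card_bounded_partitions_mem _ sBA B0 Br) -sum1_card.
by apply: eq_bigl => P; rewrite !inE.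
Qed.

(** Induction on [m]: grouping the chosen block by its size [j] leaves ['C(#|A|, j)] equal terms,
    and the double count becomes the Cauchy product of [expp r - 1] with its [m]-th power. *)
Lemma bounded_partitions_egf A r m :
  m`!%:R * #|bounded_partitions A r m|%:R =
  #|A|`!%:R * ((expp r - 1) ^+ m)`_#|A| :> rat.
Proof.
elim: m A => [|m IHm] A.
  have -> : bounded_partitions A r 0 = if A == set0 then [set set0] else set0.
    apply/setP=> P; rewrite !inE cards_eq0.
    case: (eqVneq P set0) => [->|P0]; last first.
      by rewrite andbF; case: ifP => _; rewrite !inE ?(negPf P0).
    have -> : partition set0 A = (A == set0).
      apply/idP/idP=> [/cover_partition <-|/eqP->].
        by rewrite /cover big_set0.
      by rewrite partition_set0.
    have -> : [forall B in (set0 : {set {set T}}), (#|B| <= r)%N].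
      by apply/forall_inP=> B; rewrite inE.
    by case: (A == set0); rewrite !inE ?eqxx.
  rewrite expr0 coef1 cards_eq0 mul1r.
  case: eqVneq => [->|_]; last by rewrite cards0 mulr0.
  by rewrite cards1 cards0 mulr1.
rewrite factS [in LHS]mulnC natrM -mulrA -natrM card_bounded_partitionsS.
rewrite natr_sum mulr_sumr.
(* The default value of [inord] never occurs, since [B \subset A]. *)
rewrite (partition_big (fun B => inord #|B| : 'I_#|A|.+1) predT) //=.
rewrite exprS coefM mulr_sumr; apply: eq_bigr => j _.
have leA B : B \subset A -> (inord #|B| == j) = (#|B| == j).
  by move=> sBA; rewrite -val_eqE /= inordK // ltnS subset_leq_card.
have leqjA : (j <= #|A|)%N by rewrite -ltnS.
rewrite (eq_bigr (fun=>
    (#|A| - j)`!%:R * ((expp r - 1) ^+ m)`_(#|A| - j))); last first.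
  move=> B /andP[/and3P[sBA _ _]]; rewrite leA // => /eqP <-.
  by rewrite IHm cardsD (setIidPr sBA).
rewrite coef_expp1; case: ifP => [/andP[j0 jr]|jr]; last first.
  rewrite big1 ?mul0r ?mulr0 // => B /andP[/and3P[sBA B0 Br]].
  by rewrite leA // => /eqP eqj; rewrite -eqj card_gt0 B0 Br in jr.
rewrite (eq_bigl (fun B =>
    B \in [set B : {set T} | B \subset A & #|B| == j])); last first.
  move=> B; rewrite !inE; case: (boolP (B \subset A)) => //= sBA.
  rewrite leA //; have [Bj|] := eqVneq #|B| (j : nat); rewrite ?andbF //.
  by rewrite -card_gt0 Bj j0 jr.
rewrite sumr_const cards_draws -(bin_fact leqjA) -mulr_natl !natrM.
by field; rewrite fact_neq0.
Qed.

End BoundedPartitions.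

Lemma restricted_stirling2_egf (r n m : nat) :
  m`!%:R * (restricted_stirling2 r n m)%:R =
  n`!%:R * ((expp r - 1) ^+ m)`_n :> rat.
Proof.
by have := bounded_partitions_egf [set: 'I_n] r m; rewrite cardsT card_ord.
Qed.

(** * Coefficients of powers of the truncated exponential *)

Lemma deriv_expp (q : nat) : (expp q)^`() = expp q - (q`!%:R)^-1 *: 'X^q.
Proof.
apply/polyP=> j; rewrite coef_deriv coefB coefZ coefXn !coef_expp.
case: (ltngtP j q) => [jq|jq|->]; rewrite ?mulr0 ?subr0 ?mul0rn //.
  by rewrite factS natrM invfM -[LHS]mulr_natl mulrA mulfV ?mul1r // pnatr_eq0.
by rewrite mulr1 subrr.
Qed.

(** Up to degree [q] the truncation is invisible, so the coefficients are those of exp(mt). *)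
Lemma coef_expp_exp (q m i : nat) :
  (i <= q)%N -> (expp q ^+ m)`_i = m%:R ^+ i / i`!%:R.
Proof.
elim: m i => [|m IHm] i iq.
  rewrite expr0 coef1; case: i iq => [|i] _ /=; first by rewrite divr1.
  by rewrite expr0n mul0r.
rewrite exprS coefM -natr1 exprDn mulr_suml; apply: eq_bigr => j _.
have ji : (j <= i)%N by rewrite -ltnS.
rewrite coef_expp (leq_trans ji iq) IHm ?(leq_trans (leq_subr _ _) iq) //.
rewrite expr1n mulr1 -(bin_fact ji) -mulr_natr !natrM.
by field; rewrite !fact_neq0 pnatr_eq0 -lt0n bin_gt0.
Qed.

(** Compares coefficients of t^(q+i) in (F^p)' = p F^(p-1) F', with F' replaced by [deriv_expp]. *)
Lemma coef_expp_expS (q i : nat) :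
  (q.+1 + i)%:R * (expp q ^+ q.+1)`_(q.+1 + i) =
  q.+1%:R * ((expp q ^+ q.+1)`_(q + i) - (expp q ^+ q)`_i / q`!%:R).
Proof.
rewrite mulr_natl [in LHS]addSn -coef_deriv deriv_exp deriv_expp /=.
rewrite mulrBl -exprS coefMn coefB -scalerAl coefZ coefXnM.
by rewrite ltnNge leq_addr addKn mulr_natl [_ / _]mulrC.
Qed.

(** * An alternating binomial sum for the harmonic numbers *)

(** Induction on [k]: Pascal's rule and ['C(k, i-1) / i = 'C(k+1, i) / (k+1)] split off a sum which,
    by the expansion of (1 - 1)^(k+1), equals -1/(k+1). *)
Lemma sum_sign_bin_div (k : nat) :
  \sum_(1 <= i < k.+1) (-1) ^+ i * 'C(k, i)%:R / i%:R = - harmonic k.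
Proof.
elim: k => [|k IHk]; first by rewrite /harmonic !big_geq ?oppr0.
have split_bin i : (1 <= i < k.+2)%N ->
    (-1) ^+ i * 'C(k.+1, i)%:R / i%:R =
    (-1) ^+ i * 'C(k, i)%:R / i%:R
      + (-1) ^+ i * 'C(k.+1, i)%:R / k.+1%:R :> rat.
  case: i => // i _; rewrite [in LHS]binS [in LHS]natrD mulrDr mulrDl.
  congr (_ + _); have := mul_bin_diag k.+1 i.
  move=> /(congr1 (fun n => n%:R : rat)); rewrite !natrM.
  move=> /(canRL (mulKf _)) ->; last by rewrite pnatr_eq0.
  by field; rewrite !nat1r !pnatr_eq0.
rewrite (eq_big_nat _ _ split_bin) big_split /= big_nat_recr //= IHk.
rewrite bin_small // mulr0 mul0r addr0 /harmonic [in RHS]big_nat_recr //= opprD.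
congr (_ + _); rewrite -mulr_suml; apply: (canLR (mulfVK _)).
  by rewrite invr_eq0 pnatr_eq0.
rewrite invrK mulNr mulVf ?pnatr_eq0 //.
have := exprDn (1 : rat) (-1) k.+1.
rewrite subrr expr0n /= -(big_mkord xpredT
  (fun i => 1 ^+ (k.+1 - i) * (-1) ^+ i *+ 'C(k.+1, i))) big_ltn //.
rewrite expr1n mul1r expr0 bin0 => /esym/eqP; rewrite addrC addr_eq0.
move=> /eqP sum_eq; rewrite -[RHS]sum_eq.
by apply: eq_bigr => i _; rewrite expr1n mul1r mulr_natr.
Qed.

(** * The recurrence modulo [p] *)

(* The value of b_(p+i) modulo p, where p = q.+1. *)
Lemma Zloc_expp_expS (q i : nat) : prime q.+1 -> (1 <= i <= q)%N ->
  ((expp q ^+ q.+1)`_(q.+1 + i) / q.+1%:R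
     - ((i == 1%N)%:R + (-1) ^+ i / (i%:R * i`!%:R))) / q.+1%:R \in Zloc q.+1.
Proof.
move=> p_pr; set p := q.+1.
pose b j : rat := (expp q ^+ p)`_(p + j) / p%:R.
pose c j : rat := (j == 1%N)%:R + (-1) ^+ j / (j%:R * j`!%:R).
have p0 : p%:R != 0 :> rat by rewrite pnatr_eq0.
have q0 : (0 < q)%N by rewrite -ltnS prime_gt1.
have q_inv : (q`!%:R)^-1 \in Zloc p by apply: Zloc_inv_fact.
have b_rec j : (j <= q)%N ->
    (p + j)%:R * b j = (expp q ^+ p)`_(q + j) - q%:R ^+ j / (j`!%:R * q`!%:R).
  move=> jq; rewrite mulrA coef_expp_expS (coef_expp_exp _ jq).
  by rewrite mulrAC mulfV // mul1r invfM mulrA.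
have coef_b j : (expp q ^+ p)`_(q + j.+1) = p%:R * b j.
  by rewrite /b mulrCA mulfV // mulr1 addSnnS.
have pj0 j : (p + j)%:R != 0 :> rat by rewrite pnatr_eq0.
have cop j : (1 <= j <= q)%N -> coprime p j.
  by move=> /andP[j0 jq]; rewrite prime_coprime // gtnNdvd.
have pj_inv j : (1 <= j <= q)%N -> ((p + j)%:R)^-1 \in Zloc p.
  move=> jq; apply: Zloc_invn.
  by rewrite coprime_sym /coprime gcdnDl; apply: cop.
rewrite -/(b i) -/(c i).
elim: i => // -[_ _|i IHi /andP[_ iq]].
  (* Two uses of [b_rec] give [(p + 1) b_1 = (p^q - 1 - q) / q!], and [1 + q = p]; hence [b 1] is
     divisible by [p], in agreement with [c 1 = 1 - 1 = 0]. *)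
  have eq_b1 : b 1%N = (p%:R ^+ q - p%:R) / q`!%:R / (p + 1)%:R.
    apply: (canRL (mulfK (pj0 _))); rewrite mulrC b_rec // coef_b.
    have -> : p%:R * b 0%N = (p + 0)%:R * b 0%N by rewrite addn0.
    rewrite b_rec // addn0 coef_expp_exp // fact0 factS fact0 !mul1r expr1.
    rewrite mulrBl -addrA -opprD; congr (_ - _).
    by rewrite -[p%:R]natr1 mulrDl mul1r addrC.
  have -> : c 1%N = 0 by apply/eqP.
  have -> : (b 1%N - 0) / p%:R =
      (p%:R ^+ q.-1 - 1) * (q`!%:R)^-1 * ((p + 1)%:R)^-1.
    rewrite subr0 eq_b1 -[in p%:R ^+ q](prednK q0) exprS.
    by rewrite -[X in _ - X]mulr1 -mulrBr [LHS]mulrC !mulrA mulVf // mul1r.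
  by rewrite !rpredM ?rpredB ?rpredX ?rpred_nat ?rpred1 // pj_inv.
have c_loc : c i.+1 \in Zloc p.
  rewrite /c rpredD ?rpred_nat // rpredM ?rpredX ?rpredN ?rpred1 // invfM.
  apply: rpredM; last by apply: Zloc_inv_fact => //; apply: leqW.
  by apply: Zloc_invn; rewrite coprime_sym; apply: cop; apply: ltnW.
(* Integrality of the previous term makes [p b_(i+1)] vanish modulo [p] in the recurrence. *)
have {IHi c_loc} b_loc : b i.+1 \in Zloc p.
  have -> : b i.+1 = (b i.+1 - c i.+1) / p%:R * p%:R + c i.+1.
    by rewrite divfK // subrK.
  apply: rpredD => //; apply: rpredM; last exact: rpred_nat.
  by apply: IHi; apply: ltnW.
(* Wilson's theorem: 1/(p-1)! is -1 modulo [p]. *)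
have [w wp eqw] : exists2 w, w \in Zloc p & (q`!%:R)^-1 = p%:R * w - 1 :> rat.
  move: (p_pr); rewrite (Wilson (prime_gt1 p_pr)) => /dvdnP[w eqw].
  exists (w%:R / q`!%:R); first by rewrite rpredM ?rpred_nat.
  have /(congr1 (fun n => n%:R : rat)) := eqw; rewrite natrM -natr1 /= => eqw'.
  rewrite mulrA [p%:R * _]mulrC -eqw' mulrDl mulfV ?fact_neq0 //.
  by rewrite mul1r addrAC subrr add0r.
(* [q] is -1 modulo [p]; [z] is the cofactor in the factorisation of x^n - y^n with x = q, y = -1
   and x - y = p. *)
have [z zp eqz] : exists2 z, z \in Zloc p &
    q%:R ^+ i.+2 = (-1) ^+ i.+2 + p%:R * z :> rat.
  exists (\sum_(j < i.+2) q%:R ^+ (i.+2.-1 - j) * (-1) ^+ j).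
    apply: rpred_sum => j _.
    by rewrite rpredM ?rpredX ?rpredN ?rpred1 ?rpred_nat.
  have -> : p%:R = q%:R - -1 :> rat by rewrite opprK natr1.
  by rewrite -subrXX addrC subrK.
have := b_rec _ iq; rewrite coef_b eqz invfM eqw.
have f_loc : (i.+2`!%:R)^-1 \in Zloc p by rewrite Zloc_inv_fact.
have n_loc : (i.+2%:R)^-1 \in Zloc p.
  by rewrite Zloc_invn // coprime_sym cop.
(* Since [i.+2] is not 1, the first summand of [c] computes to 0. *)
rewrite [c _]add0r.
have s_loc : (-1) ^+ i.+2 \in Zloc p by rewrite rpredX ?rpredN ?rpred1.
have pn_loc := pj_inv i.+2 iq.
have w'p : p%:R * w - 1 \in Zloc p by rewrite -eqw.
have eq_pn : (p + i.+2)%:R = p%:R + i.+2%:R :> rat by rewrite natrD.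
have := pj0 i.+2; have n0 : i.+2%:R != 0 :> rat by rewrite pnatr_eq0.
have := fact_neq0 i.+2.
move: b_loc f_loc n_loc s_loc pn_loc w'p eq_pn n0 p0.
move: (b i.+1) (b i.+2) ((-1) ^+ i.+2) (p + i.+2)%:R i.+2%:R (i.+2)`!%:R p%:R.
move=> b1 b2 s t n f P b1p fp np sp tp w'p eq_t n0 P0 f0 t0 eq_b2.
(* As [t = P + n], the two terms [s / f] without a factor [P] cancel, and dividing the rest by [P]
   leaves only integral terms. *)
have -> : (b2 - s / (n * f)) / P =
    (b1 - z * (P * w - 1) * f^-1 - s * w * f^-1 - s * n^-1 * f^-1) * t^-1.
  have -> : b2 = (P * b1 - (s + P * z) * (f^-1 * (P * w - 1))) / t.
    by rewrite -eq_b2 mulrC mulKf.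
  move: t0; rewrite eq_t => t0.
  by field; rewrite ?n0 ?P0 ?f0 ?t0.
by move: (P * w - 1) w'p => u up; do ![apply: rpredB | apply: rpredM].
Qed.

(** * The inner sum and the conclusion *)

Lemma sum_restricted_stirling2 (q n : nat) : (0 < n)%N ->
  \sum_(1 <= m < q.+2) q`!%:R / ((q.+1 - m)`!%:R * n`!%:R)
      * (restricted_stirling2 q n m)%:R =
  (expp q ^+ q.+1)`_n / q.+1%:R.
Proof.
move=> n0; rewrite -[expp q in RHS](subrK 1) exprD1n coef_sum.
rewrite -(big_mkord xpredT (fun m => ((expp q - 1) ^+ m *+ 'C(q.+1, m))`_n)).
(* The term [m = 0] is the constant 1, with no coefficient in degree [n > 0]. *)
rewrite big_ltn // expr0 bin0 coef1 (gtn_eqF n0) add0r mulr_suml.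
apply: eq_big_nat => m /andP[m0]; rewrite ltnS => mq.
have := restricted_stirling2_egf q n m => /(canRL (mulKf (fact_neq0 _))) ->.
have /(congr1 (fun n => n%:R : rat)) := bin_fact mq.
rewrite factS !natrM => eq_fact; rewrite coefMn -[X in X / _]mulr_natr.
have -> : q`!%:R =
    (q.+1%:R)^-1 * ('C(q.+1, m)%:R * (m`!%:R * (q.+1 - m)`!%:R)) :> rat.
  by rewrite eq_fact mulKf // pnatr_eq0.
have := fact_neq0 m; have := fact_neq0 n; have := fact_neq0 (q.+1 - m).
have : q.+1%:R != 0 :> rat by rewrite pnatr_eq0.
move: m`!%:R n`!%:R (q.+1 - m)`!%:R q.+1%:R => x y z t t0 z0 y0 x0.
by field; rewrite x0 y0 z0 t0.
Qed.

Theorem theorem2p7 (p k : nat) (p_prime : prime p) (p_odd : odd p)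
    (k_ge1 : (1 <= k)%N) (k_le : (k <= p - 1)%N) :
  congr_Zloc p
    (\sum_(1 <= i < k.+1)
        (1 / ((k - i)`!)%:R) *
        (\sum_(1 <= m < p.+1)
            (((p - 1)`!)%:R / (((p - m)`!)%:R * ((i + p)`!)%:R)) *
            (restricted_stirling2 (p - 1) (i + p) m)%:R)
     - 1 / ((k - 1)`!)%:R)
    (- (1 / (k`!)%:R * harmonic k)).
Proof.
case: p p_prime p_odd k_le => // q p_pr _; rewrite subn1 /= => k_le.
set lhs := _ - _; set rhs := - _.
have p0 : q.+1%:R != 0 :> rat by rewrite pnatr_eq0.
have rhs_loc : rhs \in Zloc q.+1.
  rewrite rpredN rpredM ?mul1r ?Zloc_inv_fact // /harmonic big_nat.
  apply: rpred_sum => j /andP[j0 jk]; apply: Zloc_invn.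
  by rewrite coprime_sym prime_coprime // gtnNdvd // (leq_trans jk).
(* Integrality of [lhs] is deduced from that of [rhs] and of this quotient. *)
suff diff_loc : (lhs - rhs) / q.+1%:R \in Zloc q.+1.
  split=> //; last by exists ((lhs - rhs) / q.+1%:R); rewrite // mulrC divfK.
  have -> : lhs = (lhs - rhs) / q.+1%:R * q.+1%:R + rhs by rewrite divfK ?subrK.
  by rewrite rpredD // rpredM ?rpred_nat.
have rhsE : rhs = \sum_(1 <= i < k.+1)
    1 / (k - i)`!%:R * ((-1) ^+ i / (i%:R * i`!%:R)).
  rewrite /rhs -mulrN -sum_sign_bin_div mulr_sumr; apply: eq_big_nat => i.
  rewrite ltnS => /andP[i0 ik].
  have /(congr1 (fun n => n%:R : rat)) := bin_fact ik; rewrite !natrM => <-.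
  have := fact_neq0 i; have := fact_neq0 (k - i).
  have : i%:R != 0 :> rat by rewrite pnatr_eq0 -lt0n.
  have : 'C(k, i)%:R != 0 :> rat by rewrite pnatr_eq0 -lt0n bin_gt0.
  move: i`!%:R (k - i)`!%:R i%:R 'C(k, i)%:R => x y z t t0 z0 y0 x0.
  by field; rewrite x0 y0 z0 t0.
(* The subtracted term cancels the exceptional contribution at [i = 1], so the comparison can be
   made term by term. *)
have deltaE : 1 / (k - 1)`!%:R =
    \sum_(1 <= i < k.+1) 1 / (k - i)`!%:R * (i == 1%N)%:R :> rat.
  rewrite big_ltn // eqxx mulr1 big_nat_cond big1 ?addr0 // => i.
  by rewrite andbT => /andP[i1 _]; rewrite (gtn_eqF i1) mulr0.
rewrite /lhs rhsE deltaE -!sumrB mulr_suml big_nat.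
apply: rpred_sum => i /andP[i0]; rewrite ltnS => ik.
rewrite sum_restricted_stirling2 ?addn_gt0 ?i0 // -!mulrBr -mulrA.
apply: rpredM.
  by rewrite mul1r Zloc_inv_fact // ltnS (leq_trans (leq_subr _ _)).
rewrite -addrA -opprD [(i + _)%N]addnC.
by apply: Zloc_expp_expS; rewrite // i0 (leq_trans ik).
Qed.
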